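(* Let $\varepsilon \ge 0$ and $0 \le \delta < 1$. A mechanism $M$ on $\mathsf{X}$ is $(\varepsilon,\delta)$-PDP if and only if $M$ is $(L,\mathcal{H},\varepsilon,\delta)$-PP, where $L$ is the negative log-probability score for discrete distributions and $\mathcal{H}$ is the class of two-point priors supported on a pair of neighbours.
   Context: $(\mathsf{X},\mathcal{X})$ is a measurable space of datasets with $\{x\}\in\mathcal{X}$ for all $x\in\mathsf{X}$. A mechanism $M$ is a Markov kernel from $\mathsf{X}$ to a measurable output space $(\mathsf{T},\mathcal{T})$; $M(x,\cdot)$ is the law of the output $T$ when the data is $x$, and $\mathbb{P}_x$ denotes probability under $T\sim M(x,\cdot)$. Neighbours: a symmetric binary relation $\sim$ on $\mathsf{X}$ is fixed, and $\mathfrak{N}=\{(x,x')\in\mathsf{X}^2: x'\sim x\}$. Probabilistic differential privacy: $M$ is $(\varepsilon,\delta)$-PDP if $$\inf_{x\sim x'}\mathbb{P}_x\left[ m(x,T)\le e^{\varepsilon} m(x',T)\right]\ge 1-\delta,$$ where $m(x,\cdot), m(x',\cdot)$ are the densities of $M(x,\cdot), M(x',\cdot)$ with respect to a measure dominating both (which may depend on the pair). Priors: $\mathcal{P}_2$ is the set of probability measures $Q=\sum_{z\in \mathsf{Z}}w_z\delta_z$ with $\mathsf{Z}\subset\mathsf{X}$, $|\mathsf{Z}|=2$, $w_z>0$, $\sum_z w_z=1$, and $\mathcal{H}=\{Q\in\mathcal{P}_2:\exists (z,z')\in\mathfrak{N},\ Q(\{z,z'\})=1\}$ (it does not depend on $x$).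 Score: $L(Q,x)=-\log Q(\{x\})$, with $\log 0=-\infty$. Posterior: $Q_T=Q(\cdot\mid T)$ is the Bayes update of $Q$ after observing $T$. For $Q\in\mathcal{H}$ with support $\{x,x'\}$ and $w=Q(\{x\})\in(0,1)$, this is $Q_T(\{x\})=\frac{m(x,T)w}{m(x,T)w+m(x',T)(1-w)}$; if $Q(\{x\})=0$ then $Q_T(\{x\})=0$. Persuasive privacy: for a score $S$, a class of priors $\mathcal{Q}$, $\kappa\ge 0$ and $\delta\ge0$, $M$ is $(S,\mathcal{Q},\kappa,\delta)$-PP if $$\inf_{x\in\mathsf{X}}\inf_{Q\in\mathcal{Q}}\mathbb{P}_x\left[\Delta_S(Q,T,x)\le\kappa\right]\ge 1-\delta,\qquad \Delta_S(Q,T,x)=S(Q,x)-S(Q_T,x),$$ with the convention $\infty-\infty=0$. *)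

(* Defs.v *)
From HB Require Import structures.
From mathcomp Require Import all_boot all_order all_algebra.
From mathcomp Require Import all_classical all_reals all_analysis.
From mathcomp Require Import measurable_realfun.

Set Implicit Arguments.
Unset Strict Implicit.
Unset Printing Implicit Defensive.

Import Order.TTheory GRing.Theory Num.Theory.

Local Open Scope classical_set_scope.
Local Open Scope ring_scope.

(* [nu `<< mu] is a consequence of the last clause. The base measure [mu] is
   not required to be sigma-finite: the existence of the density is enough. *)
Definition is_density d (T : measurableType d) (R : realType)
    (mu nu : {measure set T -> \bar R}) (f : T -> R) : Prop :=
  [/\ measurable_fun [set: T] f,
      forall t, 0 <= f t &
      forall B, measurable B -> nu B = (\int[mu]_(t in B) (f t)%:E)%E].

Record densities d (T : measurableType d) (R : realType)
    (nu nu' : {measure set T -> \bar R}) : Type := Densities {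
  dens_base : {measure set T -> \bar R};
  dens : T -> R;
  dens' : T -> R;
  densP : is_density dens_base nu dens;
  densP' : is_density dens_base nu' dens' }.

Definition neighbours (X : Type) (nb : X -> X -> Prop) : set (X * X) :=
  [set p | nb p.2 p.1].

(* The inner infimum runs over all base measures and all versions of the
   densities. It is an infimum of equal numbers, and it is over a nonempty
   family (see [densities_exist]). *)
Definition pdp dX dT (X : measurableType dX) (T : measurableType dT)
    (R : realType) (M : R.-pker X ~> T) (nb : X -> X -> Prop)
    (eps delta : R) : Prop :=
  ((1 - delta)%:E <=
   ereal_inf [set ereal_inf
                [set M p.1 [set t | (dens m t <= expR eps * dens' m t)%R]
                | m in [set: densities (M p.1) (M p.2)]]
             | p in neighbours nb])%E.

(* A version of the likelihood [(z, t) |-> m(z, t)] of the mechanism for the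
   prior [Q]: for Q-almost every dataset [z], [lik z] is a density of [M z]
   with respect to a base measure common to all such [z]. When [Q] is
   discrete, these [z] are the atoms of [Q]. *)
Record likelihood dX dT (X : measurableType dX) (T : measurableType dT)
    (R : realType) (M : R.-pker X ~> T) (Q : probability X R) : Type :=
  Likelihood {
    lik_base : {measure set T -> \bar R};
    lik : X -> T -> R;
    lik_ge0 : forall z t, 0 <= lik z t;
    measurable_lik : forall t, measurable_fun [set: X] (lik ^~ t);
    likP : {ae Q, forall z, is_density lik_base (M z) (lik z)} }.

Section bayes.
Context dX dT (X : measurableType dX) (T : measurableType dT) (R : realType).
Variables (M : R.-pker X ~> T) (Q : probability X R) (l : likelihood M Q).
Variable t : T.
Local Open Scope ereal_scope.

Definition joint (A : set X) : \bar R := \int[Q]_(z in A) (lik l z t)%:E.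

Let joint0 : joint set0 = 0.
Proof. exact: integral_set0. Qed.

Let joint_ge0 A : 0 <= joint A.
Proof. by apply: integral_ge0 => z _; rewrite lee_fin lik_ge0. Qed.

Let joint_sigma_additive : semi_sigma_additive joint.
Proof.
apply: semi_sigma_additive_nng_induced => [|z]; last by rewrite lee_fin lik_ge0.
by apply/measurable_EFinP; exact: measurable_lik.
Qed.

HB.instance Definition _ := isMeasure.Build _ _ _ joint
  joint0 joint_ge0 joint_sigma_additive.

(* Bayes' rule
     Q_t(A) = (\int_A m(z, t) Q(dz)) / (\int m(z, t) Q(dz)),
   where the prior is left unchanged when the denominator is 0 or +oo. For a
   two-point prior see [posterior_two_point] and [posterior_null]; when x is an
   atom of [Q], the denominator vanishes with [M x]-probability 0. *)
Definition posterior : probability X R := mnormalize joint Q.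

End bayes.

(* [a - b] with the convention oo - oo = 0 (the library has
   [+oo - +oo = -oo]). *)
Definition esub0 (R : realType) (a b : \bar R) : \bar R :=
  if a == b then 0%E else (a - b)%E.

Definition score_gain d (X : measurableType d) (R : realType)
    (S : probability X R -> X -> \bar R) (Q Q' : probability X R) (x : X) :
    \bar R :=
  esub0 (S Q x) (S Q' x).

(* The innermost infimum runs over all versions of the likelihood. For the
   score and the priors defined below, it is an infimum of equal numbers, over
   a nonempty family (see [two_point_likelihood_exist]). *)
Definition persuasive_private dX dT (X : measurableType dX)
    (T : measurableType dT) (R : realType) (M : R.-pker X ~> T)
    (S : probability X R -> X -> \bar R) (Qs : set (probability X R))
    (kappa delta : R) : Prop :=
  ((1 - delta)%:E <=
   ereal_inf [set ereal_inf [set ereal_inf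
       [set M x [set t | score_gain S Q (posterior l t) x <= kappa%:E]
       | l in [set: likelihood M Q]]
     | Q in Qs]
   | x in [set: X]])%E.

Definition two_point d (X : measurableType d) (R : realType) :
    set (probability X R) :=
  [set Q | exists z1 z2 : X, exists w1 w2 : R,
    [/\ z1 <> z2, 0 < w1, 0 < w2, w1 + w2 = 1 &
        forall A, measurable A ->
          Q A = (w1%:E * \d_z1 A + w2%:E * \d_z2 A)%E]].

Definition neighbour_priors d (X : measurableType d) (R : realType)
    (nb : X -> X -> Prop) : set (probability X R) :=
  [set Q | two_point Q /\
    exists p : X * X, neighbours nb p /\ Q [set p.1; p.2] = 1%E].

(* [lne 0 = -oo], so that the score is [+oo] when [Q [set x] = 0]. *)
Definition log_score d (X : measurableType d) (R : realType)
    (Q : probability X R) (x : X) : \bar R :=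
  (- lne (Q [set x]))%E.

Section well_definedness.
Context dX dT (X : measurableType dX) (T : measurableType dT) (R : realType).
Hypothesis measurable_pt : forall x : X, measurable [set x].
Local Open Scope ereal_scope.

Let probability_of (m : {measure set T -> \bar R}) : m setT = 1 ->
  exists P : probability T R, forall A, P A = m A.
Proof.
move=> m1; have [t _] : [set: T] !=set0.
  apply/set0P/eqP => T0; move: m1.
  by rewrite T0 measure0 => /esym/eqP; rewrite onee_eq0.
exists (mnormalize m \d_t) => A /=.
by rewrite /mnormalize m1 onee_eq0/= invr1 mule1.
Qed.

Lemma densities_exist (M : R.-pker X ~> T) (x x' : X) :
  inhabited (densities (M x) (M x')).
Proof.
have [nu nuE] := probability_of (prob_kernel (s := M) x).
have [nu' nuE'] := probability_of (prob_kernel (s := M) x').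
pose s : {measure set T -> \bar R} := measure_add nu nu'.
have sE A : s A = nu A + nu' A by exact: measure_addE.
pose mu : probability T R := mnormalize s nu.
have muE A : mu A = (nu A + nu' A) * (2^-1)%:E.
  have e : s setT = 2%:E by rewrite sE !probability_setT -EFinD.
  by rewrite /mu/= /mnormalize e eqe pnatr_eq0/= sE.
have dom (r : probability T R) :
    (forall A, r A <= nu A + nu' A) -> (r : {measure set T -> \bar R}) `<< mu.
  move=> h; apply/null_content_dominatesP => A mA.
  change (mu A = 0 -> r A = 0); rewrite muE => /eqP.
  rewrite mule_eq0 eqe invr_eq0 pnatr_eq0 orbF => /eqP s0.
  by apply/eqP; rewrite eq_le measure_ge0 andbT -s0 h.
have dens_of (r : probability T R) z : (forall A, r A = M z A) ->
    (r : {measure set T -> \bar R}) `<< mu ->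
    is_density mu (M z) (fun t => fine (Radon_Nikodym_SigmaFinite.f r mu t)).
  move=> rE rmu; split.
  - apply: measurableT_comp => //.
    by have /measurable_int := Radon_Nikodym_SigmaFinite.f_integrable rmu.
  - by move=> t; apply: fine_ge0; exact: Radon_Nikodym_SigmaFinite.f_ge0.
  - move=> B mB; rewrite -rE.
    transitivity (\int[mu]_(t in B) Radon_Nikodym_SigmaFinite.f r mu t).
      exact: Radon_Nikodym_SigmaFinite.f_integral.
    apply: eq_integral => t _.
    by rewrite fineK// Radon_Nikodym_SigmaFinite.f_fin_num.
split; apply: (Densities (dens_of nu x nuE _) (dens_of nu' x' nuE' _));
  by apply: dom => A; rewrite ?leeDl ?leeDr.
Qed.

Lemma two_point_likelihood_exist (M : R.-pker X ~> T) (Q : probability X R) :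
  two_point Q -> inhabited (likelihood M Q).
Proof.
move=> [z1 [z2 [w1 [w2 [z12 w1_gt0 w2_gt0 w12 QE]]]]].
have [m] := densities_exist M z1 z2.
pose l z t := (dens m t * \1_[set z1] z + dens' m t * \1_[set z2] z)%R.
have [_ d0 _] := densP m; have [_ d'0 _] := densP' m.
have lz1 : l z1 = dens m.
  apply/funext => t; rewrite /l !indicE mem_set// memNset//.
  by rewrite mulr1 mulr0 addr0.
have lz2 : l z2 = dens' m.
  apply/funext => t; rewrite /l !indicE memNset ?mem_set//; last exact/nesym.
  by rewrite mulr1 mulr0 add0r.
split; apply: (@Likelihood _ _ _ _ _ M Q (dens_base m) l).
- by move=> z t; rewrite addr_ge0 ?mulr_ge0.
- by move=> t; apply: measurable_funD; apply: measurable_funM => //;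
    exact: measurable_indic.
exists (~` [set z1; z2]); split.
- by apply: measurableC; exact: measurableU.
- rewrite QE; last by apply: measurableC; exact: measurableU.
  by rewrite !diracE !memNset ?mule0 ?adde0//=; tauto.
- move=> z /=; apply: contra_not => -[] ->.
    by rewrite lz1; exact: densP.
  by rewrite lz2; exact: densP'.
Qed.

Let posteriorE (M : R.-pker X ~> T) (Q : probability X R)
    (l : likelihood M Q) t A :
  posterior l t A =
  if (joint l t setT == 0) || (joint l t setT == +oo) then Q A
  else joint l t A * (fine (joint l t setT))^-1%:E.
Proof. by rewrite /posterior/= /mnormalize; case: ifP. Qed.

Lemma posterior_two_point (M : R.-pker X ~> T) (Q : probability X R)
    (l : likelihood M Q) (x x' : X) (w : R) (t : T) :
  x <> x' -> (0 < w < 1)%R ->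
  (forall A, measurable A -> Q A = w%:E * \d_x A + (1 - w)%:E * \d_x' A) ->
  let evidence := (lik l x t * w + lik l x' t * (1 - w))%R in
  evidence != 0%R ->
  posterior l t [set x] = (lik l x t * w / evidence)%:E.
Proof.
move=> xx' /andP[w_gt0 w_lt1] QE evidence ev0.
have w'_gt0 : (0 < 1 - w)%R by rewrite subr_gt0.
pose w1 := NngNum (ltW w_gt0); pose w2 := NngNum (ltW w'_gt0).
have jointE A : measurable A -> joint l t A =
    w%:E * (\d_x A * (lik l x t)%:E) + (1 - w)%:E * (\d_x' A * (lik l x' t)%:E).
  move=> mA; have mf : measurable_fun A (fun z => (lik l z t)%:E).
    by apply/measurable_EFinP/measurable_funTS; exact: measurable_lik.
  have f0 z : A z -> 0 <= (lik l z t)%:E by rewrite lee_fin lik_ge0.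
  rewrite /joint (@eq_measure_integral _ _ _ _
    (measure_add (mscale w1 (\d_x)) (mscale w2 (\d_x'))))/=; last first.
    by move=> B mB _; rewrite QE//; exact/esym/measure_addE.
  rewrite ge0_integral_measure_add// !ge0_integral_mscale//.
  by rewrite !integral_dirac.
rewrite posteriorE jointE// !diracT !mul1e -!EFinM -EFinD.
rewrite [(w * _)%R]mulrC [((1 - w) * _)%R]mulrC -/evidence eqe (negbTE ev0)/=.
rewrite jointE// !diracE mem_set// memNset; last by move=> /nesym.
by rewrite mul1e mul0e mule0 adde0 -!EFinM [(w * _)%R]mulrC.
Qed.

Lemma posterior_null (M : R.-pker X ~> T) (Q : probability X R)
    (l : likelihood M Q) (x : X) (t : T) :
  Q [set x] = 0 -> posterior l t [set x] = 0.
Proof.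
move=> Qx0; rewrite posteriorE; case: ifP => // _.
rewrite /joint null_set_integral ?mul0e//.
by apply/measurable_EFinP/measurable_funTS; exact: measurable_lik.
Qed.

End well_definedness.

(* Main.v *)
Require Import Defs.
From HB Require Import structures.
From mathcomp Require Import all_boot all_order all_algebra.
From mathcomp Require Import all_classical all_reals all_analysis.
From mathcomp Require Import measurable_realfun.
From mathcomp Require Import ring lra.

Set Implicit Arguments.
Unset Strict Implicit.
Unset Printing Implicit Defensive.

Import Order.TTheory GRing.Theory Num.Theory.
Import numFieldNormedType.Exports.
Local Open Scope classical_set_scope.
Local Open Scope ring_scope.

(** Fix neighbours [x <> x'], write [f] and [g] for the densities of [M x] and
    [M x'], and let [E = e^eps]. For the prior with weight [w] at [x] and
    [1 - w] at [x'], Bayes' rule gives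

      [Q_t(x) / Q(x) = f t / (w * f t + (1 - w) * g t)],

    so that the gain in log-score at [x] is at most [eps] exactly on the event

      [A_w = {t | f t <= E * (w * f t + (1 - w) * g t)}]

    ([score_gain_event]). The privacy event [{f <= E * g}] is the case [w = 0].
    Because [E >= 1], the events [A_w] increase with [w] ([le_mixture_mono]).

    Differential privacy implies persuasive privacy: [A_0] is contained in every
    [A_w]. When [x] is not an atom of the prior, both scores are infinite, the
    gain is [0], and nothing is left to prove.

    Persuasive privacy implies differential privacy: [A_0] is the decreasing
    limit of [A_w] as [w] tends to [0], so a lower bound on the probabilities of
    all the [A_w] passes to [A_0] by continuity from above
    ([le_measure_mixture_limit]). A single prior does not suffice here, since
    [A_w] with [w > 0] can be strictly larger than [A_0]. A pair [(x, x)]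
    supports no two-point prior; there the two densities are versions of each
    other, and the privacy event has probability [1] ([density_le_full]).

    Densities and likelihoods carry the same data on a two-point prior: a
    likelihood restricts to a pair of densities at the two atoms
    ([is_density_atom]), and a pair of densities extends to a likelihood
    ([likelihood_of_densities]). Hence the infima over versions on the two sides
    can be compared version by version. *)

(** * Two-point priors *)

(** The weight is kept explicit, with the point of interest first, because the
    proof lets the weight of that point tend to [0]. *)
Definition mixture d (X : measurableType d) (R : realType)
    (Q : probability X R) (x x' : X) (w : R) : Prop :=
  [/\ x <> x', 0 < w < 1 &
      forall A, measurable A ->
        Q A = (w%:E * \d_x A + (1 - w)%:E * \d_x' A)%E].

Lemma mixture_exists d (X : measurableType d) (R : realType) (x x' : X)
    (w : R) : x <> x' -> 0 < w < 1 ->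
  exists Q : probability X R, mixture Q x x' w.
Proof.
move=> xx' w01; have /andP[w_gt0 w_lt1] := w01.
have w'_gt0 : 0 < 1 - w by rewrite subr_gt0.
pose s : {measure set X -> \bar R} :=
  measure_add (mscale (NngNum (ltW w_gt0)) (\d_x))
  (mscale (NngNum (ltW w'_gt0)) (\d_x')).
have sE (A : set X) : s A = (w%:E * \d_x A + (1 - w)%:E * \d_x' A)%E.
  exact: measure_addE.
(* s has mass 1 already: normalizing only gives it the type of a
   probability *)
exists (mnormalize s \d_x); split => // A _.
have sT : s [set: X] = 1%E.
  by rewrite sE !diracE !in_setT !mule1 -EFinD addrC subrK.
by rewrite -sE /= /mnormalize sT onee_eq0/= invr1 mule1.
Qed.

Lemma mixtureC d (X : measurableType d) (R : realType)
    (Q : probability X R) (x x' : X) (w : R) :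
  mixture Q x x' w -> mixture Q x' x (1 - w).
Proof.
move=> [xx' /andP[w0 w1] QE]; split; first exact/nesym.
  by rewrite subr_gt0 w1 ltrBlDr ltrDl.
by move=> A mA; rewrite QE// addeC subKr.
Qed.

Section neighbour_priors.
Context d (X : measurableType d) (R : realType).
Hypothesis measurable_pt : forall x : X, measurable [set x].
Variable nb : X -> X -> Prop.

Lemma mixture_atom (Q : probability X R) (x x' : X) (w : R) :
  mixture Q x x' w -> Q [set x] = w%:E.
Proof.
move=> [xx' _ QE]; rewrite QE// !diracE mem_set// memNset; last exact/nesym.
by rewrite mule1 mule0 adde0.
Qed.

Lemma mixture_neighbour_priors (Q : probability X R) (x x' : X) (w : R) :
  mixture Q x x' w -> nb x' x -> neighbour_priors nb Q.
Proof.
move=> [xx' /andP[w0 w1] QE] nbx; split.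
  exists x, x', w, (1 - w); split=> //; first by rewrite subr_gt0.
  by rewrite addrC subrK.
exists (x, x'); split => //=; rewrite QE; last exact: measurableU.
rewrite !diracE !mem_set//=; [|by right|by left].
by rewrite !mule1 -EFinD addrC subrK.
Qed.

(** The two atoms of such a prior are the two members of the neighbouring pair
    that carries all its mass, in one order or the other. Symmetry of the
    relation makes either atom the first of a neighbouring pair. *)
Lemma neighbour_priorsP (nb_sym : forall x x' : X, nb x x' -> nb x' x)
    (Q : probability X R) (x : X) :
  neighbour_priors nb Q -> Q [set x] <> 0%E ->
  exists x' w, mixture Q x x' w /\ nb x' x.
Proof.
move=> [[z1 [z2 [w1 [w2 [z12 w1_gt0 w2_gt0 w12 QE]]]]]] [[p1 p2] [/= nbp Qp]].
have w2E : w2 = 1 - w1 by rewrite -w12 addrC addKr.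
have Q12 : mixture Q z1 z2 w1.
  by split=> //; [rewrite w1_gt0 -w12 ltrDl | rewrite -w2E].
have Q21 := mixtureC Q12.
(* an atom outside the pair would add its weight to a total mass of 1 *)
have p_atom y y' w : mixture Q y y' w -> y = p1 \/ y = p2.
  move=> Qy; apply: contrapT => yp; have [_ /andP[w0 _] _] := Qy.
  have mp : measurable [set p1; p2] by exact: measurableU.
  have : (Q [set p1; p2] + Q [set y] <= 1)%E.
    rewrite -measureU//; first by apply: probability_le1; exact: measurableU.
    by apply/seteqP; split => // z [/= zp zy]; apply: yp; rewrite -zy.
  by rewrite Qp (mixture_atom Qy) -EFinD lee_fin gerDl leNgt w0.
have nb12 : nb z1 z2 /\ nb z2 z1.
  have := p_atom _ _ _ Q12; have := p_atom _ _ _ Q21.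
  move=> -[e2|e2] -[e1|e1]; try by case: z12; rewrite e1 e2.
  - by rewrite e1 e2; split=> //; exact: nb_sym.
  - by rewrite e1 e2; split=> //; exact: nb_sym.
move=> Qx; have [xz1|xz1] := pselect (x = z1).
  by exists z2, w1; rewrite xz1; split=> //; case: nb12.
have [xz2|xz2] := pselect (x = z2).
  by exists z1, (1 - w1); rewrite xz2; split=> //; case: nb12.
exfalso; apply: Qx; rewrite QE// !diracE !memNset ?mule0 ?adde0//=.
- by move=> /esym.
- by move=> /esym.
Qed.

End neighbour_priors.

(** * The threshold events *)

(** If [a <= b], the mixture is at least [a], and [1 <= E] gives the conclusion;
    if [b < a], the mixture grows with the weight of [a]. *)
Lemma le_mixture_mono (R : realFieldType) (a b E v w : R) :
  0 <= a -> 1 <= E -> v <= w -> w <= 1 ->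
  a <= E * (a * v + b * (1 - v)) -> a <= E * (a * w + b * (1 - w)).
Proof.
move=> a0 E1 vw w1 h; have [ab|ba] := leP a b.
  have mix_ge : a <= a * w + b * (1 - w).
    rewrite -{1}[a]mulr1 -{1}(subrKC w 1) mulrDr lerD2l.
    by rewrite ler_wpM2r// subr_ge0.
  by apply: (le_trans mix_ge); rewrite ler_peMl// (le_trans a0).
by apply: (le_trans h); rewrite ler_wpM2l ?(le_trans _ E1)//; nra.
Qed.

Lemma measurable_le_set d (T : measurableType d) (R : realType) (f g : T -> R) :
  measurable_fun setT f -> measurable_fun setT g ->
  measurable [set t | f t <= g t].
Proof.
move=> mf mg; rewrite -[X in measurable X]setTI.
exact: measurable_fun_le.
Qed.

(** Continuity from above along the weights [w n = 1 / (n + 2)]: the events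
    decrease by [le_mixture_mono], and their intersection is [{f <= E * g}]
    since the inequality that defines them is closed in [w]. *)
Lemma le_measure_mixture_limit d (T : measurableType d) (R : realType)
    (nu : {measure set T -> \bar R}) (f g : T -> R) (E : R) (c : \bar R) :
  (nu setT < +oo)%E -> measurable_fun setT f -> measurable_fun setT g ->
  (forall t, 0 <= f t) -> 1 <= E ->
  (forall w : R, 0 < w < 1 ->
    (c <= nu [set t | (f t <= E * (f t * w + g t * (1 - w)))%R])%E) ->
  (c <= nu [set t | (f t <= E * g t)%R])%E.
Proof.
move=> nu_fin mf mg f0 E1 h.
(* the shift keeps the first weight below 1 *)
pose w : R^nat := fun n => harmonic n.+1.
have w0 n : 0 < w n by rewrite invr_gt0.
have w1 n : w n < 1 by rewrite invf_lt1// ltr1n.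
pose F n := [set t | f t <= E * (f t * w n + g t * (1 - w n))].
have mF n : measurable (F n).
  apply: measurable_le_set => //; apply: measurable_funM => //.
  by apply: measurable_funD; apply: measurable_funM.
have mixE (a b v : R) : a * v + b * (1 - v) = b + v * (a - b).
  by ring.
have capF : \bigcap_n F n = [set t | f t <= E * g t].
  apply/seteqP; split => t /=.
  - move=> ft; have wcvg : w @ \oo --> (0 : R)%R.
      by rewrite (cvg_shiftS (harmonic : nat -> R)); exact: cvg_harmonic.
    have : (fun n => E * (g t + w n * (f t - g t))) @ \oo -->
        (E * (g t + 0 * (f t - g t)) : R)%R.
      apply: cvgM; first exact: cvg_cst.
      apply: cvgD; first exact: cvg_cst.
      by apply: cvgM => //; exact: cvg_cst.
    rewrite mul0r addr0 => Fcvg; rewrite -(cvg_lim _ Fcvg)//.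
    apply: limr_ge; first by apply: cvgP Fcvg.
    by apply: nearW => n; have := ft n I; rewrite /F/= mixE.
  - move=> ft n _; apply: (@le_mixture_mono _ _ _ _ 0) => //; try exact: ltW.
    by rewrite mulr0 add0r subr0 mulr1.
rewrite -capF; apply: (cvge_ge (F := \oo) (f := nu \o F)); last first.
  apply: nonincreasing_cvg_mu => //.
  - by apply: le_lt_trans nu_fin; apply: le_measure; rewrite ?inE.
  - by rewrite capF; apply: measurable_le_set => //; apply: measurable_funM.
  - move=> n m nm; apply/subsetPset => t; apply: le_mixture_mono => //.
    + by rewrite lef_pV2 ?posrE// ler_nat.
    + exact: ltW.
by apply: nearW => n; apply: h; rewrite w0 w1.
Qed.

(** * Score gain of a two-point prior *)

Section mechanism.
Context dX dT (X : measurableType dX) (T : measurableType dT) (R : realType).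
Hypothesis measurable_pt : forall x : X, measurable [set x].
Variables (M : R.-pker X ~> T).

(** The first case covers an evidence that is [0] or infinite, where the prior
    is kept. In both cases the gain at [x] is nonpositive, so that the evidence has
    to be computed only where the likelihood of [x] is positive. *)
Lemma posterior_lik0 (Q : probability X R) (l : likelihood M Q) (x : X)
    (t : T) : lik l x t = 0 ->
  posterior l t [set x] = Q [set x] \/ posterior l t [set x] = 0%E.
Proof.
move=> lx0; have jx0 : joint l t [set x] = 0%E.
  by apply: integral0_eq => z /= ->; rewrite lx0.
rewrite /posterior/= /mnormalize; case: ifP => _; [by left|right].
by rewrite [X in (X * _)%E]jx0 mul0e.
Qed.

(** Where the likelihood of [x] vanishes, the gain is [0] or [-oo] and the
    inequality on the right is [0 <= _]. Elsewhere the evidence is positive, and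
    the gain is the logarithm of the ratio of posterior to prior. *)
Lemma score_gain_event (Q : probability X R) (l : likelihood M Q) (x x' : X)
    (w eps : R) : 0 <= eps -> mixture Q x x' w ->
  [set t | (score_gain (@log_score dX X R) Q (posterior l t) x <= eps%:E)%E] =
  [set t | lik l x t <=
           expR eps * (lik l x t * w + lik l x' t * (1 - w))].
Proof.
move=> eps0 mQ; have [xx' w01 QE] := mQ; have /andP[w0 w1] := w01.
have w'0 : 0 < 1 - w by rewrite subr_gt0.
have Qx := mixture_atom measurable_pt mQ.
have a_ge0 := lik_ge0 l x; have b_ge0 := lik_ge0 l x'.
apply/seteqP; rewrite /score_gain /esub0 /log_score.
suff gainE t : ((if (- lne (Q [set x]) == - lne (posterior l t [set x]))%E
    then 0 else (- lne (Q [set x]) - - lne (posterior l t [set x]))%E)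
    <= eps%:E)%E = (lik l x t <=
           expR eps * (lik l x t * w + lik l x' t * (1 - w))).
  by split=> t /=; rewrite gainE.
have [lx0|lx_neq0] := eqVneq (lik l x t) 0.
  rewrite lx0 mul0r add0r mulr_ge0 ?expR_ge0 ?mulr_ge0 ?(ltW w'0)//.
  case: ifPn => [_|ne]; first by rewrite lee_fin.
  have [e|->] := posterior_lik0 lx0; first by rewrite e eqxx in ne.
  by rewrite Qx lne_EFin// le0_lneNy//= leNye.
have lx_gt0 : 0 < lik l x t by rewrite lt_neqAle eq_sym lx_neq0 a_ge0.
set ev := lik l x t * w + _; have ev_gt0 : 0 < ev.
  by rewrite ltr_wpDr ?mulr_ge0 ?mulr_gt0// ltW.
have ev_neq0 := lt0r_neq0 ev_gt0.
rewrite (posterior_two_point measurable_pt xx' w01 QE) -/ev// Qx.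
rewrite !lne_EFin ?divr_gt0 ?mulr_gt0//.
transitivity (ln (lik l x t * w / ev) - ln w <= eps).
  case: ifPn => [|_].
    by rewrite -!EFinN eqe => /eqP/oppr_inj ->; rewrite subrr lee_fin.
  by rewrite -!EFinN -EFinD lee_fin opprK addrC.
rewrite -ln_div ?posrE ?divr_gt0 ?mulr_gt0// -[LHS]ler_expR lnK; last first.
  by rewrite posrE !divr_gt0 ?mulr_gt0.
by rewrite mulrAC mulfK ?gt_eqF// ler_pdivrMr.
Qed.

(** * Versions of the densities *)

(** An almost sure property holds at every atom. *)
Lemma is_density_atom (Q : probability X R) (l : likelihood M Q) (x : X) :
  Q [set x] <> 0%E -> is_density (lik_base l) (M x) (lik l x).
Proof.
move=> Qx; apply: contrapT => nd; apply: Qx.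
apply/eqP; rewrite eq_le measure_ge0 andbT.
have [N [mN N0 sub]] := likP l.
rewrite -N0; apply: le_measure; rewrite ?inE//.
by move=> z ->; apply: sub.
Qed.

(** The prior constrains the likelihood at the two atoms only. Setting it to [0]
    elsewhere makes it measurable in the dataset. *)
Lemma likelihood_of_densities (Q : probability X R) (x x' : X) (w : R)
    (m : densities (M x) (M x')) : mixture Q x x' w ->
  exists l : likelihood M Q, lik l x = dens m /\ lik l x' = dens' m.
Proof.
move=> [xx' w01 QE].
have [_ d0 _] := densP m; have [_ d'0 _] := densP' m.
pose f z t := dens m t * \1_[set x] z + dens' m t * \1_[set x'] z.
have fx : f x = dens m.
  apply/funext => t; rewrite /f !indicE mem_set// memNset//.
  by rewrite mulr1 mulr0 addr0.
have fx' : f x' = dens' m.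
  apply/funext => t; rewrite /f !indicE memNset ?mem_set//; last exact/nesym.
  by rewrite mulr1 mulr0 add0r.
have f0 z t : 0 <= f z t by rewrite addr_ge0 ?mulr_ge0.
have mf t : measurable_fun [set: X] (f ^~ t).
  by apply: measurable_funD; apply: measurable_funM.
have fP : {ae Q, forall z, is_density (dens_base m) (M z) (f z)}.
  exists (~` [set x; x']); split.
  - by apply: measurableC; exact: measurableU.
  - rewrite QE; last by apply: measurableC; exact: measurableU.
    by rewrite !diracE !memNset ?mule0 ?adde0//=; tauto.
  - move=> z /=; apply: contra_not => -[] ->.
      by rewrite fx; exact: densP.
    by rewrite fx'; exact: densP'.
by exists (Likelihood f0 mf fP).
Qed.

(** Two densities of the same finite measure are integrable and have equal
    integrals over every measurable set, so that they agree almost everywhere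
    for the base measure, hence also for the measure itself. *)
Lemma density_le_full (x : X) (mu : {measure set T -> \bar R}) (f g : T -> R) :
  is_density mu (M x) f -> is_density mu (M x) g ->
  M x [set t | f t <= g t] = 1%E.
Proof.
move=> [mf f0 fE] [mg g0 gE].
have M1 : M x setT = 1%E := prob_kernel x.
have mle := measurable_le_set mf mg.
have fg : ae_eq mu setT (EFin \o f) (EFin \o g).
  apply: integral_ae_eq => //.
  - apply/integrableP; split; first exact/measurable_EFinP.
    under eq_integral do rewrite /= ger0_norm//.
    by rewrite -fE// M1 ltry.
  - exact/measurable_EFinP.
  - by move=> E _ mE; rewrite -fE// gE.
have mu0 : mu (~` [set t | f t <= g t]) = 0%E.
  apply/negligibleP; first exact: measurableC.
  apply: negligibleS fg => t /= fgt; apply: contra_not fgt.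
  by move=> /(_ I)[->].
have Mc : M x (~` [set t | f t <= g t]) = 0%E.
  rewrite fE; last exact: measurableC.
  apply: null_set_integral => //; first exact: measurableC.
  by apply: measurable_funTS; exact/measurable_EFinP.
have := measureU (M x) mle (measurableC mle) (setICr _).
rewrite setUv [X in (_ + X)%E]Mc adde0 => <-; exact: M1.
Qed.

End mechanism.

Theorem proposition6 (R : realType) (dX dT : measure_display)
    (X : measurableType dX) (T : measurableType dT)
    (measurable_pt : forall x : X, measurable [set x])
    (nb : X -> X -> Prop) (nb_sym : forall x x' : X, nb x x' -> nb x' x)
    (M : R.-pker X ~> T) (eps delta : R)
    (eps_ge0 : 0 <= eps) (delta_ge0 : 0 <= delta) (delta_lt1 : delta < 1) :
  pdp M nb eps delta <->
  persuasive_private M (@log_score dX X R) (neighbour_priors nb) eps delta.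
Proof.
have M1 x : M x setT = 1%E := prob_kernel x.
have E1 : 1 <= expR eps by rewrite -expR0 ler_expR.
have c1 : ((1 - delta)%:E <= 1 :> \bar R)%E by rewrite lee_fin gerDl oppr_le0.
have mscaled (v : T -> R) : measurable_fun setT v ->
    measurable_fun setT (fun t => expR eps * v t).
  by move=> mv; exact: measurable_funM.
split=> [priv|pers].
- apply: le_ereal_inf_tmp => _ [x _ <-]; apply: le_ereal_inf_tmp => _ [Q QH <-].
  apply: le_ereal_inf_tmp => _ [l _ <-].
  have [Qx0|/eqP Qx] := eqVneq (Q [set x]) 0%E.
    (* oo - oo = 0 by convention *)
    have -> : [set t | (score_gain (@log_score dX X R) Q (posterior l t) x
        <= eps%:E)%E] = setT.
      apply/seteqP; split=> // t _ /=.
      rewrite /score_gain /log_score (posterior_null measurable_pt)// Qx0.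
      by rewrite /esub0 eqxx lee_fin.
    by rewrite M1.
  have [x' [w [mQ nbx]]] := neighbour_priorsP measurable_pt nb_sym QH Qx.
  have [xx' /andP[w0 w1] QE] := mQ.
  have Qx' : Q [set x'] <> 0%E.
    rewrite (mixture_atom measurable_pt (mixtureC mQ)).
    by apply/eqP; rewrite eqe subr_eq0 gt_eqF.
  have dx := is_density_atom measurable_pt l Qx.
  have dx' := is_density_atom measurable_pt l Qx'.
  have [ma a0 _] := dx; have [mb _ _] := dx'.
  rewrite (score_gain_event measurable_pt l eps_ge0 mQ).
  apply: (@le_trans _ _ (M x [set t | lik l x t <= expR eps * lik l x' t])).
    apply: (le_trans priv); apply: (@le_trans _ _ (ereal_inf
      [set M x [set t | (dens m t <= expR eps * dens' m t)%R]
      | m in [set: densities (M x) (M x')]])); apply: ereal_inf_lbound.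
      by exists (x, x').
    by exists (Densities dx dx').
  apply: le_measure; rewrite ?inE.
  + exact: measurable_le_set (mscaled _ _).
  + apply: measurable_le_set => //; apply: mscaled.
    by apply: measurable_funD; apply: measurable_funM.
  + move=> t /= h; apply: (@le_mixture_mono _ _ _ _ 0) => //; try exact: ltW.
    by rewrite mulr0 add0r subr0 mulr1.
- apply: le_ereal_inf_tmp => _ [[x x'] /= nbx <-].
  apply: le_ereal_inf_tmp => _ [m _ <-].
  have [ma a0 aE] := densP m; have [mb b0 bE] := densP' m.
  have [xx'|xx'] := pselect (x = x').
    have bP : is_density (dens_base m) (M x) (dens' m).
      have := densP' m; move: (dens_base m) (dens' m) => mu g.
      by rewrite -xx'.
    rewrite (le_trans c1)// -(density_le_full (densP m) bP).
    apply: le_measure; rewrite ?inE.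
    + exact: measurable_le_set.
    + exact: measurable_le_set (mscaled _ _).
    + by move=> t /= /le_trans; apply; rewrite ler_peMl.
  apply: le_measure_mixture_limit => //; first by rewrite M1 ltry.
  move=> w w01; have [Q mQ] := mixture_exists xx' w01.
  have [l [lx lx']] := likelihood_of_densities measurable_pt m mQ.
  rewrite -lx -lx' -(score_gain_event measurable_pt l eps_ge0 mQ).
  apply: (le_trans pers); apply: (le_trans (ereal_inf_lbound _)).
    by exists x.
  apply: (le_trans (ereal_inf_lbound _)).
    by exists Q => //; exact: mixture_neighbour_priors mQ nbx.
  by apply: ereal_inf_lbound; exists l.
Qed.
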